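(* The path graph $P_n$ is not an MPF graph.
   Context: $P_n$ denotes the path graph on $n$ vertices. A simple graph is an undirected graph without loops or multiple edges. A labeling of a graph on $n$ vertices is a bijection from its vertex set to $\{1,\ldots,n\}$; it determines the adjacency matrix $A(\cdot)$ of the graph. For graphs $G$ and $H$ without loops on $n$ vertices, with labelings $g$ and $h$ respectively, the pair $((G,g),(H,h))$ is called graphical if $A(G)A(H)$ (adjacency matrices taken with respect to $g$ and $h$) is a symmetric $(0,1)$-matrix; the graphical matrix product of $(G,g)$ and $(H,h)$ is then the undirected graph whose adjacency matrix is $A(G)A(H)$. A simple graph $X$ is an MPF (matrix product factorizable) graph if there exist a graphical pair $((G,g),(H,h))$ of simple graphs and a labeling of $X$ such that, with respect to these labelings, $A(G)A(H)=A(X)$.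
   Formalization: The claim is stated for paths with n ≥ 2 vertices; for n = 1 it is false, since the one-vertex path has zero adjacency matrix and is the graphical product of two one-vertex graphs. *)

(* Defs.v *)
From mathcomp Require Import all_boot all_algebra.
Set Implicit Arguments.
Unset Strict Implicit.
Unset Printing Implicit Defensive.
Import GRing.Theory.
Local Open Scope ring_scope.

Record sgraph := SGraph {
  vertex :> finType;
  adj : rel vertex;
  adj_sym : symmetric adj;
  adj_irrefl : irreflexive adj
}.

(* The labels 1, ..., n are represented by the ordinals 0, ..., n - 1. A
   bijection is given together with its inverse, so a labeling in 'I_n exists
   only when G has exactly n vertices. *)
Record labeling (n : nat) (G : sgraph) := Labeling {
  label : G -> 'I_n;
  unlabel : 'I_n -> G;
  labelK : cancel label unlabel;
  unlabelK : cancel unlabel label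
}.

Definition adjmx (n : nat) (G : sgraph) (g : labeling n G) : 'M[int]_n :=
  \matrix_(i, j) (adj (unlabel g i) (unlabel g j))%:R.

Definition graphical (n : nat) (G H : sgraph)
    (g : labeling n G) (h : labeling n H) : Prop :=
  let M := adjmx g *m adjmx h in
  M^T = M /\ (forall i j, M i j = 0 \/ M i j = 1).

Definition MPF (X : sgraph) : Prop :=
  exists (G H : sgraph) (g : labeling #|X| G) (h : labeling #|X| H)
         (x : labeling #|X| X),
    graphical g h /\ adjmx g *m adjmx h = adjmx x.

Definition path_adj (n : nat) : rel 'I_n :=
  fun i j => (i.+1 == j :> nat) || (j.+1 == i :> nat).

Lemma path_adj_sym (n : nat) : symmetric (@path_adj n).
Proof. by move=> i j; rewrite /path_adj orbC. Qed.

Lemma path_adj_irrefl (n : nat) : irreflexive (@path_adj n).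
Proof. by move=> i; rewrite /path_adj orbb; apply/negbTE; rewrite gtn_eqF. Qed.

Definition path_graph (n : nat) : sgraph :=
  SGraph (@path_adj_sym n) (@path_adj_irrefl n).

(* Main.v *)
Require Import Defs.
From mathcomp Require Import all_boot all_algebra.
From mathcomp Require Import zify.

Set Implicit Arguments.
Unset Strict Implicit.
Unset Printing Implicit Defensive.

(** Suppose the path [P] on the vertices [0, ..., n - 1] factors as
    [A(P) = A(G) A(H)], and transport [G] and [H] to the vertices of [P].
    Since all three matrices are symmetric, they commute.

    An end vertex has a single neighbour in [P] and no vertex of [P] is
    isolated, so the vertex [0] has a single neighbour [k] in [G]
    ([factorization_leaf]).  A matrix commuting with the path is determined by
    its row [0] (algebraically, [A(G)] is the Chebyshev polynomial [U_k] of
    [A(P)]).  Two consequences of this rigidity suffice: every edge [ij] of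
    [G] satisfies [i + j >= k] and [i + j = k] modulo [2]
    ([path_commute_support]), and all pairs with [i + j = k] are edges
    ([path_commute_antidiagonal]).  An even [k] would then give a loop at [k / 2], so
    [k] is odd and every edge of [G] joins vertices of opposite parity
    ([path_commute_parity]).

    The same holds for [H].  Hence an edge of [G] followed by an edge of [H]
    joins vertices of equal parity, whereas the edge [01] of [P] must be
    obtained in this way.  All arguments need only the supports of the
    matrices and the fact that the entries of the product are at most [1]. *)

(** Combinatorial content of an equation [A(G) A(H) = A(X)]: [a], [b] and [p]
    are the adjacency relations of [G], [H] and [X] on a common vertex set. *)
Record factorization (T : Type) (p a b : rel T) : Prop := Factorization {
  fact_sym : symmetric p;
  fact_syml : symmetric a;
  fact_symr : symmetric b;
  fact_irrefl : irreflexive a;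
  fact_irrefr : irreflexive b;
  factP : forall i j, p i j <-> exists2 m, a i m & b m j;
  fact_uniq : forall i j m m',
    a i m -> b m j -> a i m' -> b m' j -> m = m'
}.

Lemma MPF_factorization (X : sgraph) :
  MPF X -> exists a b : rel X, factorization (@adj X) a b.
Proof.
case=> G [H] [g] [h] [x] [_ eq_gh].
pose a : rel X := fun u v =>
  adj (unlabel g (label x u)) (unlabel g (label x v)).
pose b : rel X := fun u v =>
  adj (unlabel h (label x u)) (unlabel h (label x v)).
have card_ab (u v : X) : #|[pred m | a u m && b m v]| = adj u v.
  have /matrixP/(_ (label x u) (label x v)) := eq_gh.
  rewrite !mxE !labelK (reindex (label x)) /=; last first.
    by exists (unlabel x) => w _; rewrite ?labelK ?unlabelK.
  under eq_bigr => m _ do rewrite !mxE -GRing.natrM mulnb.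
  rewrite -GRing.natr_sum => /eqP; rewrite Num.Theory.eqr_nat => /eqP <-.
  apply: etrans (esym (sum1_card _)) _.
  by rewrite big_mkcond; apply: eq_bigr => m _; case: ifP => [|]; rewrite inE => ->.
exists a, b; split; try by [exact: adj_sym | move=> ? ?; apply: adj_sym
                           | move=> ?; apply: adj_irrefl].
- move=> u v; split=> [uv|[m um mv]].
    have /card_gt0P[m /andP[um mv]] : 0 < #|[pred m | a u m && b m v]|.
      by rewrite card_ab uv.
    by exists m.
  have : 0 < #|[pred m | a u m && b m v]|.
    by apply/card_gt0P; exists m; apply/andP.
  by rewrite card_ab lt0b.
- move=> u v m m' um mv um' mv'.
  have /card_le1_eqP : #|[pred m | a u m && b m v]| <= 1.
    by rewrite card_ab leq_b1.
  by apply; rewrite inE /= ?um ?um'.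
Qed.

(** Transposing the matrix equation exchanges the two factors. *)
Lemma factorization_swap {T : Type} {p a b : rel T} :
  factorization p a b -> factorization p b a.
Proof.
case=> ps sa sb ia ib ab u; split=> // [i j|i j m m' im mj im' mj'].
  rewrite ps ab; split=> -[m jm mi]; exists m; by rewrite 1?sa 1?sb.
by apply: (u j i); rewrite 1?sa 1?sb.
Qed.

(** The relational form of [X A = (A B) A = A (B A) = A X]. *)
Lemma factorization_commute {T : Type} {p a b : rel T} :
  factorization p a b ->
  forall i m j, p i m -> a m j -> exists2 t, a i t & p t j.
Proof.
move=> F i m j /(factP F)[t it tm] mj; exists t => //.
by apply/(factP (factorization_swap F)); exists m.
Qed.

(** If [m'] is an [a]-neighbour of [v], then it has some [b]-neighbour, which
    is a [p]-neighbour of [v] and so must be [w].  Thus every [a]-neighbour of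
    [v] is the midpoint of a walk from [v] to [w], and there is only one. *)
Lemma factorization_leaf {T : Type} {p a b : rel T} {v w : T} :
    factorization p a b -> (forall u, exists t, p u t) ->
    p v w -> (forall u, p v u -> u = w) ->
  exists2 k, a v k & forall m, a v m -> m = k.
Proof.
move=> F noiso vw leaf; have [k vk kw] := (factP F v w).1 vw.
exists k => // m vm; have [t mt] := noiso m.
have [s ms _] := (factP (factorization_swap F) m t).1 mt.
have sw : s = w by apply: leaf; apply/(factP F); exists m.
by apply: (fact_uniq F vm _ vk kw); rewrite -sw.
Qed.

(** Commutation turns an edge [(i + 1, j)] of [a] into an edge [(i, j - 1)]
    or [(i, j + 1)], so the constraints on row [0] propagate to all rows. *)
Lemma path_commute_support {n : nat} {a : rel 'I_n} (o k : 'I_n) :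
    (forall i m j, path_adj i m -> a m j -> exists2 t, a i t & path_adj t j) ->
    o = 0 :> nat -> (forall m, a o m -> m = k) ->
  forall i j, a i j -> k <= i + j /\ odd (i + j) = odd k.
Proof.
move=> comm o0 row0 i; move: {2}(val i) (erefl (val i)) => r.
elim: r i => [|r IHr] i /= ir j ij.
  have io : i = o by apply: val_inj; rewrite /= ir o0.
  by move: ij; rewrite io o0 => /row0->.
have ltr : r < n by have := ltn_ord i; lia.
have [||t rt tj] := comm (Ordinal ltr) i j => //.
  by rewrite /path_adj /= ir eqxx.
have [/=] := IHr (Ordinal ltr) erefl t rt.
by move: tj; rewrite /path_adj ir => /orP[] /eqP; lia.
Qed.

(** An edge [(i, j)] of [a] with [i + j = k] makes [(i, j - 1)] a nonzero
    entry of the product of [a] and the path.  Everything strictly below the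
    antidiagonal vanishes, so this entry can only come from [(i + 1, j - 1)]. *)
Lemma path_commute_antidiagonal {n : nat} {a : rel 'I_n} (o k : 'I_n) :
    symmetric a ->
    (forall i m j, path_adj i m -> a m j -> exists2 t, a i t & path_adj t j) ->
    o = 0 :> nat -> a o k -> (forall m, a o m -> m = k) ->
  forall r, r <= k -> exists i j, [/\ a i j, i = r :> nat & i + j = k].
Proof.
move=> sa comm o0 ok row0; elim=> [|r IHr] rk.
  by exists o, k; rewrite o0.
have [i [j [ij ir ijk]]] := IHr (ltnW rk).
have ltj : j.-1 < n by have := ltn_ord j; lia.
have [||t jt ti] := comm (Ordinal ltj) j i; last 1 first.
- (* [t] is [i - 1] or [i + 1]; the former lies below the antidiagonal. *)
  have [/= + _] := path_commute_support comm o0 row0 jt.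
  exists t, (Ordinal ltj); split; first by rewrite sa.
    by move: ti; rewrite /path_adj => /orP[] /eqP; lia.
  by move: ti; rewrite /= /path_adj => /orP[] /eqP; lia.
- by rewrite /path_adj /=; apply/orP; left; apply/eqP; lia.
- by rewrite sa.
Qed.

Lemma path_commute_parity {n : nat} {a : rel 'I_n} (o k : 'I_n) :
    symmetric a -> irreflexive a ->
    (forall i m j, path_adj i m -> a m j -> exists2 t, a i t & path_adj t j) ->
    o = 0 :> nat -> a o k -> (forall m, a o m -> m = k) ->
  forall i j, a i j -> odd (i + j).
Proof.
move=> sa ia comm o0 ok row0 i j ij.
have [_ ->] := path_commute_support comm o0 row0 ij.
apply/negPn/negP => evenk.
(* For even [k] the middle of the antidiagonal is a diagonal entry. *)
have [|u [v [uv uk uvk]]] :=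
  path_commute_antidiagonal sa comm o0 ok row0 (r := k./2); first by lia.
have eq_uv : u = v by apply: val_inj => /=; lia.
by move: uv; rewrite eq_uv ia.
Qed.

Lemma path_factor_parity {n : nat} {a b : rel 'I_n.+2} :
  factorization (@path_adj n.+2) a b -> forall i j, a i j -> odd (i + j).
Proof.
move=> F.
have noiso (u : 'I_n.+2) : exists t, path_adj u t.
  case: (posnP u) => [u0|u_gt0].
    by exists (inord 1); rewrite /path_adj inordK // u0.
  exists (inord u.-1); rewrite /path_adj inordK; last by have := ltn_ord u; lia.
  by rewrite prednK // eqxx orbT.
have [||k ok row0] := factorization_leaf (v := ord0) (w := inord 1) F noiso.
- by rewrite /path_adj inordK.
- move=> u; rewrite /path_adj /= orbF => /eqP u1.
  by apply: val_inj; rewrite /= inordK.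
exact: (path_commute_parity (fact_syml F) (fact_irrefl F)
          (factorization_commute F) (erefl : @ord0 n.+1 = 0 :> nat) ok row0).
Qed.

Theorem proposition3p9 (n : nat) (hn : 1 < n) : ~ MPF (path_graph n).
Proof.
case: n hn => [|[|n]] // _ /MPF_factorization[a [b F]].
have [] := factP F (ord0 : 'I_n.+2) (inord 1 : 'I_n.+2).
case=> [|m om m1 _]; first by rewrite /= /path_adj inordK.
have := path_factor_parity F om.
have := path_factor_parity (factorization_swap F) m1.
by rewrite inordK //=; lia.
Qed.
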